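(* If $f\in\mathcal{L}^E$ is satisfied in some belief structure (resp. possibility structure), then $f$ is satisfied in a belief structure (resp. possibility structure) $(W,\nu,\pi)$ such that $|W|\le|f|^2$, the mass function corresponding to $\nu$ is positive on at most $|f|$ subsets of $W$, the mass of each of these subsets is a rational number of size $O(|f|\,\|f\|+|f|\log|f|)$, and $\pi(w)(p)=\text{false}$ for every $w\in W$ and every primitive proposition $p$ not appearing in $f$.
   Context: Language $\mathcal L^E$: fix primitive propositions $\Phi_0$; propositional formulas built with $\neg,\wedge$; $\mathit{true}$ a tautology. A propositional gamble is $b_1\phi_1+\cdots+b_n\phi_n$ (integers $b_i$); formulas are Boolean combinations of expectation inequalities $a_1e(\gamma_1)+\cdots+a_ke(\gamma_k)\ge b$ (integers $a_i,b$). A belief structure is $(W,\mathrm{Bel},\pi)$ with $W$ nonempty, $\mathrm{Bel}$ a belief function on $W$ ($\mathrm{Bel}(\emptyset)=0$, $\mathrm{Bel}(W)=1$, $\mathrm{Bel}(\bigcup_{i=1}^nU_i)\ge\sum_{\emptyset\ne I\subseteq\{1..n\}}(-1)^{|I|+1}\mathrm{Bel}(\bigcap_{j\in I}U_j)$), $\pi$ a truth assignment to $\Phi_0$ at each world; a possibility structure is $(W,\mathrm{Poss},\pi)$ with $\mathrm{Poss}(\emptyset)=0$, $\mathrm{Poss}(W)=1$, $\mathrm{Poss}(U\cup V)=\max(\mathrm{Poss}(U),\mathrm{Poss}(V))$. $[\![\phi]\!]_M$ is the set of worlds satisfying $\phi$, $[\![\sum b_i\phi_i]\!]_M=\sum b_iX_{[\![\phi_i]\!]_M}$;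 for a finite-range gamble $X$ with values $x_1<\cdots<x_n$ and $\nu\in\{\mathrm{Bel},\mathrm{Poss}\}$, $E_\nu(X)=x_1+\sum_{i<n}(x_{i+1}-x_i)\nu(X>x_i)$; $M\models\sum a_ie(\gamma_i)\ge b$ iff $\sum a_iE_\nu([\![\gamma_i]\!]_M)\ge b$. The mass function of a belief function $\mathrm{Bel}$ on finite $W$ is the unique $m:2^W\to[0,1]$ with $m(\emptyset)=0$ and $\mathrm{Bel}(U)=\sum_{V\subseteq U}m(V)$; the mass function of a possibility measure $\mathrm{Poss}$ is that of the belief function $U\mapsto1-\mathrm{Poss}(W\setminus U)$. $|f|$ is the number of symbols in $f$ (each coefficient one symbol); $\|f\|$ is the binary length of the longest coefficient; size of rational $a/b$ in lowest terms is $\|a\|+\|b\|$. *)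

(* Defs.v *)
From HB Require Import structures.
From mathcomp Require Import all_boot all_order all_algebra.
From mathcomp Require Import boolp classical_sets reals.
From Stdlib Require Import PeanoNat.

Set Implicit Arguments.
Unset Strict Implicit.
Unset Printing Implicit Defensive.

Import Order.TTheory GRing.Theory Num.Theory.
Local Open Scope classical_set_scope.
Local Open Scope ring_scope.

Inductive pform : Type :=
| PAtom of nat
| PNot of pform
| PAnd of pform & pform.

(* propositional gamble  b_1 phi_1 + ... + b_n phi_n *)
Definition gamble := seq (int * pform).

(* Boolean combinations of  a_1 e(g_1) + ... + a_k e(g_k) >= b *)
Inductive fml : Type :=
| Ineq of seq (int * gamble) & int
| FNot of fml
| FAnd of fml & fml.

(* |f| : number of symbols, each coefficient counting as one symbol.  *)
Fixpoint psize (p : pform) : nat :=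
  match p with
  | PAtom _ => 1
  | PNot q => (psize q).+1
  | PAnd q r => (psize q + psize r).+1
  end.

(* b_1 phi_1 + ... + b_n phi_n : n coefficients, the phi_i, n-1 plus signs *)
Definition gsize (g : gamble) : nat :=
  (\sum_(t <- g) (1 + psize t.2))%N + (size g).-1.

(* a_1 e(g_1) + ... + a_k e(g_k) >= b : k coefficients, k symbols e,
   the g_i, k-1 plus signs, the symbol >= and the coefficient b *)
Fixpoint fsize (f : fml) : nat :=
  match f with
  | Ineq ts b => ((\sum_(t <- ts) (2 + gsize t.2))%N + (size ts).-1 + 2)%N
  | FNot g => (fsize g).+1
  | FAnd g h => (fsize g + fsize h).+1
  end.

(* binary length of an integer (of its absolute value; 0 has length 1) *)
Definition bitlen (z : int) : nat := (Nat.log2 (absz z)).+1.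

Definition gmaxlen (g : gamble) : nat := (\max_(t <- g) bitlen t.1)%N.

Fixpoint fmaxlen (f : fml) : nat :=
  match f with
  | Ineq ts b => maxn (bitlen b) (\max_(t <- ts) maxn (bitlen t.1) (gmaxlen t.2))%N
  | FNot g => fmaxlen g
  | FAnd g h => maxn (fmaxlen g) (fmaxlen h)
  end.

Definition ratsize (q : rat) : nat := (bitlen (numq q) + bitlen (denq q))%N.

Fixpoint patoms (p : pform) : seq nat :=
  match p with
  | PAtom n => [:: n]
  | PNot q => patoms q
  | PAnd q r => patoms q ++ patoms r
  end.

Definition gatoms (g : gamble) : seq nat := flatten (map (fun t => patoms t.2) g).

Fixpoint fatoms (f : fml) : seq nat :=
  match f with
  | Ineq ts _ => flatten (map (fun t => gatoms t.2) ts)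
  | FNot g => fatoms g
  | FAnd g h => fatoms g ++ fatoms h
  end.

Section Semantics.
Variables (R : realType) (W : Type).

Definition is_belief (nu : set W -> R) : Prop :=
  [/\ nu set0 = 0, nu setT = 1,
      (forall U, 0 <= nu U <= 1) &
      forall (n : nat) (U : 'I_n -> set W),
        \sum_(I : {set 'I_n} | (0 < #|I|)%N)
            (-1) ^+ (#|I|.+1) * nu [set w | forall j, j \in I -> U j w]
        <= nu [set w | exists j, U j w]].

Definition is_possibility (nu : set W -> R) : Prop :=
  [/\ nu set0 = 0, nu setT = 1 &
      forall U V, nu (U `|` V) = Num.max (nu U) (nu V)].

Variable pi : W -> nat -> bool.

Fixpoint peval (w : W) (p : pform) : bool :=
  match p with
  | PAtom n => pi w n
  | PNot q => ~~ peval w q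
  | PAnd q r => peval w q && peval w r
  end.

Definition pden (p : pform) : set W := [set w | peval w p].

Definition gval (g : gamble) (w : W) : int :=
  \sum_(t <- g) (if peval w t.2 then t.1 else 0).

(* all subset sums of the coefficients: a finite superset of the range *)
Fixpoint gcands (g : gamble) : seq int :=
  match g with
  | [::] => [:: 0]
  | t :: g' => gcands g' ++ map (fun v => v + t.1) (gcands g')
  end.

Definition grange (g : gamble) : seq int :=
  sort (fun x y : int => x <= y)
    (undup (filter (fun v => `[< exists w, gval g w = v >]) (gcands g))).

Fixpoint esum (nu : set W -> R) (X : W -> int) (xs : seq int) : R :=
  match xs with
  | x :: ((y :: _) as rest) =>
      (y - x)%:~R * nu [set w | x < X w] + esum nu X rest
  | _ => 0
  end.

Definition Echoquet (nu : set W -> R) (X : W -> int) (xs : seq int) : R :=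
  match xs with
  | x :: _ => x%:~R + esum nu X xs
  | [::] => 0
  end.

Definition expect (nu : set W -> R) (g : gamble) : R :=
  Echoquet nu (gval g) (grange g).

Fixpoint sat (nu : set W -> R) (f : fml) : Prop :=
  match f with
  | Ineq ts b => b%:~R <= \sum_(t <- ts) t.1%:~R * expect nu t.2
  | FNot g => ~ sat nu g
  | FAnd g h => sat nu g /\ sat nu h
  end.

End Semantics.

Definition is_mass (R : realType) (W : finType) (nu : set W -> R)
  (m : {set W} -> R) : Prop :=
  m (finset.set0 : {set W}) = 0 /\
  forall U : {set W}, nu [set w | w \in U] = \sum_(V : {set W} | V \subset U) m V.

Definition poss_dual (R : realType) (W : Type) (nu : set W -> R) : set W -> R :=
  fun U => 1 - nu (~` U).

(* Main.v *)
(** Only finitely many truth assignments to the atoms of [f] matter, so a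
    structure satisfying [f] may be taken finite.  Its measure is then a convex
    combination of 0/1-valued measures attached to focal sets: by Moebius
    inversion for a belief function, and by peeling off level sets, which form a
    chain, for a possibility measure.  The Choquet expectation of a gamble is the
    same combination of its minima (resp. maxima) over the focal sets, so that the
    truth values of the inequalities of [f] become signs of integer linear forms
    in the weights.  A basic solution of this homogeneous system uses at most one
    focal set per inequality, plus one for the normalisation, and Cramer's rule
    bounds its weights.  Finally each focal set is replaced by witnesses of the
    extrema of the gambles of [f] on it. *)

From Stdlib Require PeanoNat.
Require Import Defs.
From HB Require Import structures.
From mathcomp Require Import boolp classical_sets reals.
(* Imported last: [set0], [subsetP], ... are those of finite sets. *)
From mathcomp Require Import all_boot all_order all_algebra perm zify.

Set Implicit Arguments.
Unset Strict Implicit.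
Unset Printing Implicit Defensive.

Import Order.TTheory GRing.Theory Num.Theory.
Local Open Scope classical_set_scope.
Local Open Scope ring_scope.

(** * Small solutions of integer linear systems *)

Definition entries_le (R : numDomainType) m n (B : R) (A : 'M[R]_(m, n)) :
  Prop := forall i j, `|A i j| <= B.

Definition cramer_bound (R : numDomainType) n (B : R) : R := n`!%:R * B ^+ n.

Section DeterminantBounds.
Variables (R : numDomainType) (B : R).

Lemma cramer_bound_ge0 n : 0 <= B -> 0 <= cramer_bound n B.
Proof. by move=> B_ge0; rewrite mulr_ge0 ?exprn_ge0. Qed.

Lemma le_cramer_bound m n : 1 <= B -> (m <= n)%N ->
  cramer_bound m B <= cramer_bound n B.
Proof.
move=> B_ge1 le_mn; rewrite ler_pM ?ler_nat ?leq_fact ?ler_weXn2l //.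
by rewrite exprn_ge0 // (le_trans ler01).
Qed.

Lemma normr_det_le n (Q : 'M[R]_n) :
  entries_le B Q -> `|\det Q| <= cramer_bound n B.
Proof.
move=> Q_le; apply: le_trans (ler_norm_sum _ _ _) _.
rewrite /cramer_bound mulr_natl -card_Sn -sumr_const; apply: ler_sum => s _.
rewrite normrM normrX normrN1 expr1n mul1r normr_prod.
rewrite -[in leRHS](card_ord n) -prodr_const.
by apply: ler_prod => i _; rewrite normr_ge0 Q_le.
Qed.

Lemma normr_cofactor_le n (Q : 'M[R]_n) i j :
  entries_le B Q -> `|cofactor Q i j| <= cramer_bound n.-1 B.
Proof.
move=> Q_le; rewrite normrM normrX normrN1 expr1n mul1r.
by apply: normr_det_le => k l; rewrite !mxE.
Qed.

Lemma normr_adj_mulmx_le n p (Q : 'M[R]_n) (E : 'M[R]_(n, p)) :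
  entries_le B Q -> entries_le B E ->
  entries_le (cramer_bound n B) (\adj Q *m E).
Proof.
move=> Q_le E_le i j; rewrite mxE; apply: le_trans (ler_norm_sum _ _ _) _.
have -> : cramer_bound n B = \sum_(k < n) cramer_bound n.-1 B * B.
  rewrite sumr_const card_ord -[RHS]mulr_natl /cramer_bound.
  by case: n i {Q E Q_le E_le} => [[]//|n _]; rewrite exprSr !mulrA -natrM.
apply: ler_sum => k _; rewrite normrM mxE ler_pM //.
exact: normr_cofactor_le.
Qed.

End DeterminantBounds.

Lemma mulmx_col'_row' (R : pzRingType) m n p (A : 'M[R]_(m, n))
    (Z : 'M[R]_(n, p)) i :
  row i Z = 0 -> A *m Z = col' i A *m row' i Z.
Proof.
case: n A Z i => [A Z []//|n] A Z i /rowP Zi; apply/matrixP => r s.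
rewrite !mxE (bigD1_ord i) //=; have := Zi s; rewrite !mxE => ->.
by rewrite mulr0 add0r; apply: eq_bigr => k _; rewrite !mxE.
Qed.

Definition supp n (v : 'cV[int]_n) : {pred 'I_n} := [pred i | v i 0 != 0].

Lemma sum_le_card_supp n (v : 'cV[int]_n) b :
  (forall j, v j 0 <= b) -> \sum_j v j 0 <= b *+ #|supp v|.
Proof.
move=> v_le; rewrite (bigID (mem (supp v))) /= [X in _ + X]big1 ?addr0.
  by rewrite -sumr_const ler_sum.
by move=> j; rewrite inE negbK => /eqP.
Qed.

(* The size of a basic solution of [m] equations with coefficients up to [B]. *)
Definition basic_size m (B : int) n (mu : 'cV[int]_n) : Prop :=
  (forall i, 0 <= mu i 0 <= cramer_bound m B) /\ (#|supp mu| <= m)%N.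

Section IntegerSystems.
Variable R : realFieldType.
Local Notation "A ^R" := (map_mx intr A : 'M[R]_(_, _)) (at level 2).

Lemma cramer_row_full m n (A : 'M[int]_(m, n)) (e : 'cV[int]_m) (z : 'cV[R]_n)
    (B : int) :
  entries_le B A -> entries_le B e -> row_full A^R -> A^R *m z = e^R ->
  exists (d : int) (a : 'cV[int]_n),
    [/\ 0 < d, a^R = d%:~R *: z & entries_le (cramer_bound n B) a].
Proof.
move=> A_le e_le A_full Az; pose f := fullrankfun A_full.
pose Q := rowsub f A; pose b := \adj Q *m rowsub f e.
have detQ_neq0 : \det Q != 0.
  have := fullrowsub_unit A_full; rewrite -/f -map_mxsub.
  by rewrite unitmxE unitfE det_map_mx intr_eq0.
have bE : b^R = (\det Q)%:~R *: z.
  rewrite map_mxM map_mx_adj !map_mxsub /= -Az -mul_rowsub_mx mulmxA mul_adj_mx.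
  by rewrite -map_mxsub det_map_mx mul_scalar_mx.
exists `|\det Q|, (Num.sg (\det Q) *: b); split=> [||i j].
- by rewrite normr_gt0.
- by rewrite map_mxZ bE scalerA -rmorphM /= -normrEsg.
- rewrite mxE normrM normr_sg detQ_neq0 mul1r.
  by apply: normr_adj_mulmx_le => k l; rewrite mxE.
Qed.

(* The largest multiple of a kernel vector that keeps the entries nonnegative is
   subtracted from [y]. *)
Lemma caratheodory_step m n (A : 'M[R]_(m, n)) (y : 'cV[R]_n) :
  (forall i, 0 <= y i 0) -> ~~ row_full A ->
  exists (z : 'cV[R]_n) i,
    [/\ forall j, 0 <= z j 0, A *m z = A *m y & z i 0 = 0].
Proof.
move=> y_ge0; rewrite -cokermx_eq0.
move: (cokermx A) (mulmx_coker A) => N AN /matrix0Pn [i0 [k Nik_neq0]].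
pose v := N i0 k *: col k N.
have Av : A *m v = 0 by rewrite -scalemxAr colE mulmxA AN mul0mx scaler0.
have vi0_gt0 : 0 < v i0 0.
  by rewrite 2!mxE -expr2 lt0r sqr_ge0 sqrf_eq0 Nik_neq0.
pose t i := y i 0 / v i 0.
have [/= i vi_gt0 t_min] := @arg_minP _ _ _ i0 (fun i => 0 < v i 0) t vi0_gt0.
have ti_ge0 : 0 <= t i by rewrite divr_ge0 // ltW.
have zE j : (y - t i *: v) j 0 = y j 0 - t i * v j 0 by rewrite 3!mxE.
exists (y - t i *: v), i; split=> [j||].
- rewrite zE subr_ge0.
  have [vj_gt0|vj_le0] := ltP 0 (v j 0); first by rewrite -ler_pdivlMr // t_min.
  exact: le_trans (mulr_ge0_le0 _ _) _.
- by rewrite mulmxBr -scalemxAr Av scaler0 subr0.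
- by rewrite zE divfK ?subrr ?gt_eqF.
Qed.

Lemma exists_scale_ge1 (K : finType) (P : pred K) (s : K -> R) :
  (forall k, P k -> 0 < s k) ->
  exists2 c, 0 <= c & forall k, P k -> 1 <= c * s k.
Proof.
move=> s_gt0; exists (\sum_(k | P k) (s k)^-1) => [|k Pk].
  by apply: sumr_ge0 => k /s_gt0 sk_gt0; rewrite invr_ge0 ltW.
rewrite -ler_pdivrMr ?s_gt0 // mul1r (bigD1 k) //= lerDl.
by apply: sumr_ge0 => l /andP [/s_gt0 sl_gt0 _]; rewrite invr_ge0 ltW.
Qed.

Section BasicSolutions.
Variable B : int.
Hypothesis B_ge1 : 1 <= B.

Let B_ge0 : 0 <= B := le_trans ler01 B_ge1.

Lemma basic_solution_row_full m n (A : 'M[int]_(m, n)) (e : 'cV[int]_m)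
    (y : 'cV[R]_n) :
  entries_le B A -> entries_le B e -> (forall i, 0 <= y i 0) ->
  row_full A^R -> A^R *m y = e^R ->
  exists (d : int) (mu : 'cV[int]_n),
    [/\ 0 < d, A *m mu = d *: e & basic_size m B mu].
Proof.
move=> A_le e_le y_ge0 A_full Ay.
have le_nm : (n <= m)%N by rewrite -(eqP A_full) rank_leq_row.
have [d [mu [d_gt0 muE mu_le]]] := cramer_row_full A_le e_le A_full Ay.
exists d, mu; split=> //.
  have /matrixP AmuE : (A *m mu)^R = (d *: e)^R.
    by rewrite map_mxM map_mxZ muE -scalemxAr Ay.
  apply/matrixP => k l; apply: (@intr_inj R).
  by have := AmuE k l; rewrite mxE => ->; rewrite mxE.
split=> [i|].
  have mu_ge0 : 0 <= mu i 0.
    have /colP/(_ i) := muE; rewrite !mxE -(ler0z R) => ->.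
    by rewrite mulr_ge0 // ler0z ltW.
  rewrite mu_ge0 -[mu i 0]ger0_norm //.
  exact: le_trans (mu_le i 0) (le_cramer_bound B_ge1 le_nm).
by apply: leq_trans le_nm; rewrite -[leqRHS]card_ord max_card.
Qed.

Lemma basic_solution m n (A : 'M[int]_(m, n)) (e : 'cV[int]_m) (y : 'cV[R]_n) :
  entries_le B A -> entries_le B e -> (forall i, 0 <= y i 0) ->
  A^R *m y = e^R ->
  exists (d : int) (mu : 'cV[int]_n),
    [/\ 0 < d, A *m mu = d *: e & basic_size m B mu].
Proof.
move=> + e_le; elim: n A y => [|n IH] A y A_le y_ge0 Ay;
  have [A_full|] := boolP (row_full A^R).
- exact: basic_solution_row_full Ay.
- by rewrite /row_full eqn_leq rank_leq_col.
- exact: basic_solution_row_full Ay.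
case/(caratheodory_step y_ge0) => [z [i [z_ge0 Az zi]]].
have row_z : row i z = 0 by apply/rowP => j; rewrite !mxE ord1.
have col'_z : (col' i A)^R *m row' i z = A^R *m y.
  by rewrite map_col' -mulmx_col'_row'.
have [k l|k||d [mu [d_gt0 muE [mu_bound mu_supp]]]] := IH (col' i A) (row' i z).
- by rewrite mxE.
- by rewrite mxE.
- by rewrite col'_z -Ay.
pose ext : 'cV_n.+1 := \col_k oapp (fun l => mu l 0) 0 (unlift i k).
have row'_ext : row' i ext = mu by apply/colP => l; rewrite !mxE liftK.
exists d, ext; split=> //.
  rewrite (mulmx_col'_row' _ (i := i)) ?row'_ext //.
  by apply/rowP => j; rewrite !mxE unlift_none.
split=> [k|].
  rewrite mxE; case: unliftP => [l _|_] /=; first exact: mu_bound.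
  exact: cramer_bound_ge0.
apply: leq_trans mu_supp; rewrite -(card_imset _ (@lift_inj _ i)).
apply: subset_leq_card; apply/fintype.subsetP => k; rewrite inE mxE.
by case: unliftP => [l -> mu_l|//]; apply: imset_f.
Qed.

(* Slack variables turn the inequalities into equations. *)
Lemma basic_solution_ge m n (A : 'M[int]_(m, n)) (e : 'cV[int]_m)
    (y : 'cV[R]_n) :
  entries_le B A -> entries_le B e -> (forall i, 0 <= y i 0) ->
  (forall k, (e k 0)%:~R <= (A^R *m y) k 0) ->
  exists (d : int) (mu : 'cV[int]_n),
    [/\ 0 < d, forall k, d * e k 0 <= (A *m mu) k 0 & basic_size m B mu].
Proof.
move=> A_le e_le y_ge0 Ay.
have [|i||d [mu [d_gt0 muE [mu_bound mu_supp]]]] :=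
  @basic_solution m (n + m) (row_mx A (- 1%:M)) e
    (col_mx y (A^R *m y - e^R)) _ e_le.
- move=> i j; rewrite mxE; case: split => l //.
  by rewrite !mxE normrN normr_nat; case: eqP => _; rewrite ?B_ge0.
- by rewrite mxE; case: split => l //; have := Ay l; rewrite -subr_ge0 !mxE.
- by rewrite map_row_mx map_mxN map_mx1 mul_row_col mulNmx mul1mx subKr.
exists d, (usubmx mu); split=> // [k|].
  have /colP/(_ k) : A *m usubmx mu - dsubmx mu = d *: e.
    by rewrite -muE -[in RHS](vsubmxK mu) mul_row_col mulNmx mul1mx.
  rewrite [in RHS]mxE => <-; rewrite mxE gerDl mxE oppr_le0 mxE.
  by have /andP [] := mu_bound (rshift n k).
split=> [i|]; first by rewrite mxE; apply: mu_bound.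
apply: leq_trans mu_supp; rewrite -(card_imset _ (@lshift_inj n m)).
apply: subset_leq_card; apply/fintype.subsetP => _ /imsetP [j mu_j ->].
by move: mu_j; rewrite !inE mxE.
Qed.

(* Scaling [x] turns the strict inequalities into inequalities [1 <= _]. *)
Lemma small_solution m n (A : 'M[int]_(m, n)) (lax : pred 'I_m) (x : 'cV[R]_n) :
  entries_le B A -> (forall j, 0 <= x j 0) ->
  (forall k, 0 < (A^R *m x) k 0 ?<= if lax k) ->
  exists2 mu : 'cV[int]_n,
    forall k, 0 < (A *m mu) k 0 ?<= if lax k & basic_size m B mu.
Proof.
move=> A_le x_ge0 Ax.
have [c c_ge0 c_scale] : exists2 c : R, 0 <= c &
    forall k, ~~ lax k -> 1 <= c * (A^R *m x) k 0.
  by apply: exists_scale_ge1 => k /negbTE strict; have := Ax k; rewrite strict.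
pose e := \col_k (~~ lax k)%:R : 'cV[int]_m.
have [k l|j|k|d [mu [d_gt0 Amu mu_size]]] :=
  @basic_solution_ge _ _ A e (c *: x) A_le.
- by rewrite mxE normr_nat; case: (lax k); rewrite ?B_ge0.
- by rewrite mxE mulr_ge0.
- rewrite -scalemxAr mxE [X in _ <= X]mxE; have := Ax k.
  by have [_ Axk|/c_scale] := boolP (lax k); rewrite //= mulr_ge0.
exists mu => // k; have := Amu k; rewrite mxE.
by case: (lax k); rewrite /= ?mulr0 // mulr1; apply: lt_le_trans.
Qed.

(* A violated inequality [0 <= (A x)_k] is the strict inequality
   [0 < (- A x)_k], and one more row excludes the zero vector. *)
Lemma small_sign_vector m n (A : 'M[int]_(m, n)) (x : 'cV[R]_n) :
  entries_le B A -> (forall j, 0 <= x j 0) -> 0 < \sum_j x j 0 ->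
  exists mu : 'cV[int]_n,
    [/\ 0 < \sum_j mu j 0,
        forall k, (0 <= (A *m mu) k 0) = (0 <= (A^R *m x) k 0) &
        basic_size m.+1 B mu].
Proof.
move=> A_le x_ge0 x_sum_gt0; pose holds k := 0 <= (A^R *m x) k 0.
pose C : 'M[int]_(1 + m, n) :=
  col_mx (const_mx 1) (\matrix_(k, j) ((-1) ^+ (~~ holds k) * A k j)).
have mulCE (T : pzRingType) (f : {rmorphism int -> T}) (z : 'cV[T]_n) k :
    (map_mx f C *m z) k 0 =
      if split k is inr l then (-1) ^+ (~~ holds l) * (map_mx f A *m z) l 0
      else \sum_j z j 0.
  rewrite mxE; under eq_bigr do rewrite !mxE.
  case: split => l; under eq_bigr do rewrite mxE.
    by apply: eq_bigr => j _; rewrite rmorph1 mul1r.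
  rewrite mxE mulr_sumr; apply: eq_bigr => j _.
  by rewrite rmorphM rmorph_sign mulrA mxE.
pose lax (k : 'I_(1 + m)) := if split k is inr l then holds l else false.
have [i j||k|mu Cmu mu_size] := @small_solution _ _ C lax x.
- by rewrite mxE; case: split => l; rewrite mxE ?normr1 ?normrMsign.
- exact: x_ge0.
- rewrite mulCE /lax; case: split => l //=.
  have [Axl|Axl] := boolP (holds l); first by rewrite mul1r.
  by rewrite /= expr1 mulN1r oppr_gt0 ltNge.
have mulCmuE k := esym (mulCE _ idfun mu k); rewrite !map_mx_id // in mulCmuE.
exists mu; split=> // [|k].
  by have := Cmu (unsplit (inl 0)); rewrite -mulCmuE /lax unsplitK.
have := Cmu (unsplit (inr k)); rewrite -mulCmuE /lax unsplitK -/(holds k).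
case: (holds k) => /=; first by rewrite mul1r.
by rewrite expr1 mulN1r oppr_gt0 ltNge => /negbTE.
Qed.

End BasicSolutions.
End IntegerSystems.

(** * Rational distributions of small size *)

Lemma log2_trunc_log n : Nat.log2 n = trunc_log 2 n.
Proof.
have [->//|n_gt0] := posnP n; apply: PeanoNat.Nat.log2_unique; first lia.
have pow_expn k : Nat.pow 2 k = (2 ^ k)%N.
  by elim: k => // k IH; rewrite expnS -IH /=; lia.
have := trunc_logP (isT : 1 < 2)%N n_gt0.
have := trunc_log_ltn n (isT : 1 < 2)%N.
by rewrite !pow_expn; lia.
Qed.

Lemma normz_le_bitlen (z : int) k : (bitlen z <= k)%N -> `|z| <= 2 ^+ k.
Proof.
move=> zk; apply: (@le_trans _ _ (2 ^+ bitlen z)); last by rewrite ler_weXn2l.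
rewrite -abszE -natrX natz lez_nat /bitlen log2_trunc_log.
by rewrite ltnW ?trunc_log_ltn.
Qed.

Lemma bitlen_le (z : int) k : `|z| <= 2 ^+ k -> (bitlen z <= k.+1)%N.
Proof.
rewrite -abszE -natrX natz lez_nat /bitlen log2_trunc_log ltnS => zk.
by rewrite -(@trunc_expnK 2 k) // leq_trunc_log.
Qed.

Lemma ratsize_frac_le (a b : int) k :
  b != 0 -> `|a| <= `|b| -> `|b| <= 2 ^+ k ->
  (ratsize (a%:Q / b%:Q) <= k.+1.*2)%N.
Proof.
move=> b_neq0; rewrite /ratsize -addnn; case: (divqP a b) => [/eqP|c q c_neq0].
  by rewrite (negPf b_neq0).
rewrite !normrM ler_pM2l ?normr_gt0 // => num_le_den den_le.
have {}den_le : `|denq q| <= 2 ^+ k.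
  by apply: le_trans den_le; rewrite ler_peMl // -gtz0_ge1 normr_gt0.
by apply: leq_add; apply: bitlen_le => //; apply: le_trans den_le.
Qed.

Definition distribution (R : numDomainType) (J : finType) (x : J -> R) : Prop :=
  (forall j, 0 <= x j) /\ \sum_j x j = 1.

Lemma distribution_card_gt0 (R : numDomainType) (J : finType) (x : J -> R) :
  distribution x -> (0 < #|J|)%N.
Proof.
case=> _ x_sum; rewrite lt0n; apply: contra_eqN x_sum => /eqP /card0_eq J0.
by rewrite big_pred0 ?(eq_sym 0) ?oner_neq0.
Qed.

Lemma distribution_ratr (R : realFieldType) (J : finType) (y : J -> rat) :
  distribution y -> distribution (fun j => ratr (y j) : R).
Proof.
case=> y_ge0 y_sum; split=> [j|]; first by rewrite ler0q.
by rewrite -rmorph_sum y_sum rmorph1.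
Qed.

Lemma distribution_enum_val (R : numDomainType) (J : finType) (x : J -> R)
    (A : {pred J}) :
  (forall j, j \notin A -> x j = 0) -> distribution x ->
  distribution (x \o @enum_val _ A).
Proof.
move=> x_off_A [x_ge0 x_sum]; split=> [j|]; first exact: x_ge0.
rewrite -(big_enum_val x) -x_sum [RHS](bigID (mem A)) /=.
by rewrite [X in _ + X]big1 ?addr0.
Qed.

Lemma small_distribution (R : realFieldType) m n (A : 'M[int]_(m, n))
    (x : 'I_n -> R) (B : int) k :
  1 <= B -> entries_le B A -> distribution x ->
  m.+1%:R * cramer_bound m.+1 B <= 2 ^+ k ->
  exists y : 'I_n -> rat,
    [/\ distribution y,
        forall i, (0 <= \sum_j ratr (y j) * (A i j)%:~R :> R) =
                  (0 <= \sum_j x j * (A i j)%:~R),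
        (#|[pred j | y j != 0%R]| <= m.+1)%N &
        forall j, (ratsize (y j) <= k.+1.*2)%N].
Proof.
move=> B_ge1 A_le [x_ge0 x_sum] bound_le.
have [j||mu [M_gt0 mu_sign [mu_bound mu_supp]]] :=
  @small_sign_vector R B B_ge1 _ _ A (\col_j x j) A_le.
- by rewrite mxE.
- by under eq_bigr do rewrite mxE; rewrite x_sum.
pose M := \sum_j mu j 0; rewrite -/M in M_gt0.
have mu_ge0 j : 0 <= mu j 0 by have /andP [] := mu_bound j.
have mu_le_M j : mu j 0 <= M by rewrite /M (bigD1 j) //= lerDl sumr_ge0.
have M_le : M <= 2 ^+ k.
  have mu_le j : mu j 0 <= cramer_bound m.+1 B by have /andP [] := mu_bound j.
  apply: le_trans (sum_le_card_supp mu_le) (le_trans _ bound_le).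
  rewrite -[leLHS]mulr_natl ler_wpM2r ?ler_nat //.
  exact: cramer_bound_ge0 (le_trans ler01 B_ge1).
pose y j := (mu j 0)%:Q / M%:Q.
have ratr_y j : ratr (y j) = (mu j 0)%:~R / M%:~R :> R.
  by rewrite rmorphM fmorphV /= !ratr_int.
exists y; split=> [|i||j].
- split=> [j|]; first by rewrite divr_ge0 // ler0z // ltW.
  by rewrite -mulr_suml -rmorph_sum divff // intr_eq0 gt_eqF.
- have -> : \sum_j x j * (A i j)%:~R = (map_mx intr A *m \col_j x j) i 0 :> R.
    by rewrite mxE; apply: eq_bigr => j _; rewrite !mxE mulrC.
  rewrite -mu_sign; have -> : \sum_j ratr (y j) * (A i j)%:~R =
      ((A *m mu) i 0)%:~R / M%:~R :> R.
    rewrite mxE rmorph_sum mulr_suml; apply: eq_bigr => j _.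
    by rewrite ratr_y rmorphM mulrC mulrA.
  by rewrite pmulr_lge0 ?invr_gt0 ?ltr0z // ler0z.
- apply: leq_trans mu_supp; apply: subset_leq_card; apply/subsetP => j.
  by rewrite !inE mulf_eq0 negb_or intr_eq0 => /andP [].
- by apply: ratsize_frac_le; rewrite ?gt_eqF // ?(gtr0_norm M_gt0) // ger0_norm.
Qed.

(** * Moebius inversion and maxitive functions *)

Lemma sum_sign_subset (R : comPzRingType) (T : finType) (D : {set T}) :
  \sum_(I : {set T} | I \subset D) (-1) ^+ #|I| = (D == set0)%:R :> R.
Proof.
have -> : (D == set0)%:R = \prod_(t : T) (- (t \in D)%:R + 1) :> R.
  have [->|/set0Pn [t tD]] := eqVneq D set0.
    by rewrite big1 // => t _; rewrite inE oppr0 add0r.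
  by rewrite (bigD1 t) //= tD addNr mul0r.
rewrite bigA_distr big_mkcond; apply: eq_bigr => I _.
rewrite -big_mkcond /= prodrN -natr_prod.
have [/subsetP ID|/subsetPn [t tI tD]] := boolP (I \subset D).
  by rewrite big1 ?mulr1 // => t /ID ->.
by rewrite (bigD1 t) //= (negPf tD) mul0n mulr0.
Qed.

Lemma sum_sign_nonempty (R : comPzRingType) (T : finType) (U : {set T}) :
  \sum_(I : {set T} | (0 < #|I|)%N) (-1) ^+ #|I|.+1 * (I \subset U)%:R
  = (U != set0)%:R :> R.
Proof.
have := sum_sign_subset R U; rewrite (bigD1 set0) ?sub0set //=.
rewrite cards0 expr0 => /(canRL (addKr _)) sumE.
have -> : (U != set0)%:R = - (-1 + (U == set0)%:R) :> R.
  by case: eqP => _ /=; rewrite ?addNr ?addr0 ?oppr0 ?opprK.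
rewrite -sumE -sumrN big_mkcond [RHS]big_mkcond; apply: eq_bigr => I _.
rewrite card_gt0 andbC; case: (I != _) => //=.
by case: (I \subset U); rewrite ?mulr0 // mulr1 exprS mulN1r.
Qed.

Lemma sum_sign_interval (R : comPzRingType) (T : finType) (B U : {set T}) :
  \sum_(V : {set T} | (B \subset V) && (V \subset U)) (-1) ^+ #|V :\: B|
  = (B == U)%:R :> R.
Proof.
have [BU|nBU] := boolP (B \subset U); last first.
  rewrite big_pred0 => [|V].
    by case: eqP nBU => // ->; rewrite subxx.
  by apply: contraNF nBU => /andP [/subset_trans]; apply.
rewrite (reindex_onto (fun I => B :|: I)%SET (fun V => V :\: B)%SET) /=;
  last first.
  by move=> V /andP [/setIidPr {1}<- _]; rewrite setID.
have diffE I : ((B :|: I) :\: B = I :\: B)%SET by rewrite setDUl setDv set0U.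
transitivity (\sum_(I : {set T} | I \subset U :\: B) (-1) ^+ #|I| : R).
  apply: eq_big => [I|I].
    rewrite subsetUl subUset BU diffE subsetD /=.
    by congr andb; apply/eqP/idP => [/setDidPl|/setDidPl].
  by rewrite diffE => /andP [_ /eqP ->].
by rewrite sum_sign_subset setD_eq0 eqEsubset BU.
Qed.

Section Mobius.
Variables (R : comPzRingType) (T : finType) (beta : {set T} -> R).

Definition mobius (V : {set T}) : R :=
  \sum_(B : {set T} | B \subset V) (-1) ^+ #|V :\: B| * beta B.

Lemma mobiusK (U : {set T}) :
  \sum_(V : {set T} | V \subset U) mobius V = beta U.
Proof.
rewrite (exchange_big_dep predT) //=.
under eq_bigr => B _.
  rewrite -mulr_suml; under eq_bigl do rewrite andbC.
  rewrite sum_sign_interval; over.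
rewrite (bigD1 U) //= eqxx mul1r big1 ?addr0 // => B /negPf ->.
by rewrite mul0r.
Qed.

Lemma mobius_complement (V : {set T}) :
  mobius V = \sum_(I : {set T} | I \subset V) (-1) ^+ #|I| * beta (V :\: I)%SET.
Proof.
have diffK (I : {set T}) : I \subset V -> (V :\: (V :\: I) = I)%SET.
  by move=> /setIidPr IV; rewrite setDDr setDv set0U.
rewrite /mobius.
rewrite (reindex_onto (fun I => V :\: I)%SET (fun I => V :\: I)%SET) //=.
apply: eq_big => [I|I /andP [_ /eqP -> //]].
rewrite subsetDl; apply/eqP/idP => [<-|/diffK //].
exact: subsetDl.
Qed.

End Mobius.

Definition nested (J : Type) (T : finType) (V : J -> {set T}) : Prop :=
  forall i j, (V i \subset V j) || (V j \subset V i).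

Section Maxitive.
Variables (R : realDomainType) (T : finType).

Definition maxitive (nu : {set T} -> R) : Prop :=
  nu set0 = 0 /\ {morph nu : A B / A :|: B >-> Num.max A B}.

Lemma maxitive_ge0 nu U : maxitive nu -> 0 <= nu U.
Proof. by case=> nu0 nuU; rewrite -[U]setU0 nuU nu0 le_max lexx orbT. Qed.

Lemma maxitive_support nu : maxitive nu ->
  exists S : {set T}, forall U : {set T}, (0 < nu U) = ~~ [disjoint S & U].
Proof.
move=> nuM; have [nu0 nuU] := nuM; pose N := (\bigcup_(U | nu U == 0) U)%SET.
have nuN : nu N = 0.
  rewrite /N; elim/big_ind: _ => // [A B nuA nuB|A /eqP //].
  by rewrite nuU nuA nuB maxxx.
exists (~: N)%SET => U; rewrite disjoint_sym disjoints_subset setCK.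
rewrite lt0r maxitive_ge0 // andbT; congr (~~ _).
apply/idP/idP => [U_null|/setUidPr UN]; first exact: (bigcup_sup U).
by rewrite eq_le maxitive_ge0 // andbT -nuN -UN nuU le_max lexx.
Qed.

Lemma maxitive_truncate nu c : 0 <= c -> maxitive nu ->
  maxitive (fun U => Num.max 0 (nu U - c)).
Proof.
move=> c_ge0 [nu0 nuU]; split=> [|A B].
  by rewrite nu0 sub0r (max_idPl _) // oppr_le0.
by rewrite nuU addr_maxl maxACA maxxx.
Qed.

(* [S] is the set of points of positive possibility and [c] the least positive
   value of [nu]. *)
Lemma maxitive_peel nu (U0 : {set T}) : maxitive nu -> 0 < nu U0 ->
  exists (S : {set T}) (c : R) (nu' : {set T} -> R),
    [/\ 0 < c /\ S != set0, maxitive nu',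
        (#|[pred U | (0 < nu' U)%R]| < #|[pred U | (0 < nu U)%R]|)%N,
        forall U : {set T}, 0 < nu' U -> ~~ [disjoint S & U] &
        forall U, nu U = nu' U + c * (~~ [disjoint S & U])%:R].
Proof.
move=> nuM U0_pos; have [S S_pos] := maxitive_support nuM.
have [/= U1 U1_pos c_min] := @arg_minP _ _ _ U0 (fun U => 0 < nu U) nu U0_pos.
exists S, (nu U1), (fun U => Num.max 0 (nu U - nu U1)).
have nu_null U : ~~ (0 < nu U) -> nu U = 0.
  by rewrite -leNgt => U_le0; apply/eqP; rewrite eq_le U_le0 maxitive_ge0.
split=> [|||U|U].
- split=> //; apply: contraTneq U0_pos => S0.
  by rewrite S_pos S0 disjoints_subset sub0set.
- exact: maxitive_truncate (ltW U1_pos) nuM.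
- apply: proper_card; apply/properP; split.
    apply/subsetP => U; rewrite !inE lt_max ltxx subr_gt0 /=.
    exact: lt_trans.
  by exists U1; rewrite !inE // subrr maxxx ltxx.
- by rewrite lt_max ltxx subr_gt0 -S_pos; apply: lt_trans.
- rewrite -S_pos; have [U_pos|/nu_null ->] := boolP (0 < nu U).
    by rewrite mulr1 (max_idPr _) ?subr_ge0 ?c_min // subrK.
  by rewrite sub0r mulr0 addr0 (max_idPl _) // oppr_le0 ltW.
Qed.

Lemma maxitive_mass nu : maxitive nu ->
  exists m : {set T} -> R,
    [/\ m set0 = 0, forall V, 0 <= m V, {in [pred V | 0 < m V] &, nested id} &
        forall U, nu U = \sum_V m V * (~~ [disjoint V & U])%:R].
Proof.
have [n] := ubnP #|[pred U | (0 < nu U)%R]|.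
elim: n nu => // n IH nu card_n nuM.
have [/existsP [U0 U0_pos]|/existsPn nu_null] := boolP [exists U, 0 < nu U];
  last first.
  exists (fun=> 0); split=> // [V U|U]; first by rewrite inE ltxx.
  rewrite big1 => [|V _]; last by rewrite mul0r.
  by apply/eqP; rewrite eq_le maxitive_ge0 // andbT leNgt nu_null.
have [S [c [nu' [[c_gt0 S_neq0] nu'M card_nu' nu'_pos nuE]]]] :=
  maxitive_peel nuM U0_pos.
have [|m' [m'0 m'_ge0 m'_nested nu'E]] := IH nu' _ nu'M.
  exact: leq_trans card_nu' _.
have m'_sub V : 0 < m' V -> V \subset S.
  move=> m'V; rewrite -(setCK S) -disjoints_subset.
  apply: contraT => VS; have /nu'_pos : 0 < nu' (~: S)%SET.
    apply: lt_le_trans m'V _; rewrite nu'E (bigD1 V) //= VS mulr1 lerDl.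
    by rewrite sumr_ge0 // => U _; rewrite mulr_ge0.
  by rewrite disjoints_subset setCK subxx.
have focal V : 0 < m' V + c * (V == S)%:R -> V = S \/ 0 < m' V.
  by have [->|_] := eqVneq V S; [left|rewrite mulr0 addr0; right].
exists (fun V => m' V + c * (V == S)%:R); split=> [|V|V U|U].
- by rewrite m'0 eq_sym (negPf S_neq0) mulr0 addr0.
- by rewrite addr_ge0 // mulr_ge0 // ltW.
- rewrite !inE => /focal [->|m'V] /focal [->|m'U].
  + by rewrite subxx.
  + by rewrite m'_sub ?orbT.
  + by rewrite m'_sub.
  + exact: m'_nested.
- rewrite nuE nu'E; under [RHS]eq_bigr do rewrite mulrDl.
  rewrite big_split /=; congr (_ + _).
  rewrite (bigD1 S) //= eqxx mulr1 big1 ?addr0 // => V /negbTE ->.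
  by rewrite mulr0 mul0r.
Qed.

End Maxitive.

(** * Choquet expectations of mixtures of focal sets *)

Variant measure_kind := Belief | Possibility.

Definition is_measure (R : realType) W (k : measure_kind) :
  (set W -> R) -> Prop :=
  match k with
  | Belief => @is_belief R W
  | Possibility => @is_possibility R W
  end.

(* The value at [U] of the belief function (resp. possibility measure) all of
   whose mass sits on the focal set [V]. *)
Definition favors W (k : measure_kind) (V U : set W) : bool :=
  match k with
  | Belief => `[< V `<=` U >]
  | Possibility => `[< V `&` U !=set0 >]
  end.

Definition mixture (R : pzRingType) (W J : finType) (k : measure_kind)
    (x : J -> R) (V : J -> {set W}) (U : set W) : R :=
  \sum_j x j * (favors k [set` V j] U)%:R.

Definition is_extremum W (k : measure_kind) (X : W -> int) (V : set W) (w : W) :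
  Prop :=
  V w /\ forall u, V u ->
    match k with Belief => X w <= X u | Possibility => X u <= X w end.

Section Favors.
Variable W : Type.
Implicit Types (V U : set W) (k : measure_kind).

Lemma favors_setT k V : V !=set0 -> favors k V [set: W].
Proof. by case: k => -[w Vw]; apply/asboolP => //; exists w. Qed.

Lemma favors_set0 k V : V !=set0 -> favors k V classical_sets.set0 = false.
Proof.
case=> w Vw; apply/negP.
by case: k => /asboolP; [move=> /(_ _ Vw)|case=> u []].
Qed.

Lemma favors_setU V A B :
  favors Possibility V (A `|` B) =
    favors Possibility V A || favors Possibility V B.
Proof.
rewrite /favors classical_sets.setIUr -asbool_or; apply: asbool_equiv_eq.
split=> [[w [VA|VB]]|[[w VA]|[w VB]]].
- by left; exists w.
- by right; exists w.
- by exists w; left.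
- by exists w; right.
Qed.

Lemma favors_belief_setC V U :
  favors Belief V U = ~~ favors Possibility V (~` U).
Proof.
apply/asboolP/negP => [VU /asboolP [w [/VU]] //|nVU w Vw].
by apply: contrapT => nU; apply: nVU; apply/asboolP; exists w.
Qed.

Lemma favors_gt k (X : W -> int) V w c :
  is_extremum k X V w -> favors k V [set u | c < X u] = (c < X w).
Proof.
case: k => -[Vw ext]; apply/asboolP/idP => [sub|c_lt].
- exact: sub.
- by move=> u /ext; apply: lt_le_trans.
- by case: sub => u [/ext Xu c_lt]; apply: lt_le_trans Xu.
- by exists w.
Qed.

End Favors.

Section FiniteSets.
Variable T : finType.
Implicit Types V U : {set T}.

Lemma set_finsetK (U : set T) : [set` [set t | `[< U t >]]%SET] = U.
Proof. by apply/seteqP; split=> t /=; rewrite inE => /asboolP. Qed.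

Lemma set_finset0 : [set` (set0 : {set T})] = classical_sets.set0.
Proof. by apply/seteqP; split=> t //=; rewrite inE. Qed.

Lemma set_finset_nonempty V : V != set0 -> [set` V] !=set0.
Proof. by move/set0Pn. Qed.

Lemma favors_belief V U : favors Belief [set` V] [set` U] = (V \subset U).
Proof. exact/asboolP/subsetP. Qed.

Lemma favors_possibility V U :
  favors Possibility [set` V] [set` U] = ~~ [disjoint V & U].
Proof.
apply/asboolP/pred0Pn => [[t [/= tV tU]]|[t /andP [tV tU]]].
  by exists t; apply/andP.
by exists t.
Qed.

Lemma extremum_exists k (X : T -> int) V :
  V != set0 -> exists w, is_extremum k X [set` V] w.
Proof.
case/set0Pn=> w0 Vw0; case: k.
  by have [w Vw w_min] := @arg_minP _ _ _ w0 (mem V) X Vw0; exists w.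
by have [w Vw w_max] := @arg_maxP _ _ _ w0 (mem V) X Vw0; exists w.
Qed.

Lemma gval_extremum_choice (J : finType) k (pi : T -> nat -> bool)
    (V : J -> {set T}) :
  (forall j, V j != set0) ->
  exists w : J -> gamble -> T,
    forall j g, is_extremum k (gval pi g) [set` V j] (w j g).
Proof.
move=> V_neq0; have /choice [w w_ext] (p : J * gamble) :
    exists w, is_extremum k (gval pi p.2) [set` V p.1] w.
  exact: extremum_exists.
by exists (fun j g => w (j, g)) => j g; apply: w_ext (j, g).
Qed.

End FiniteSets.

Section GambleValues.
Variables (W : Type) (pi : W -> nat -> bool).

Lemma gval_gcands g w : gval pi g w \in gcands g.
Proof.
elim: g => [|t g IH]; first by rewrite /gval big_nil inE.
rewrite /gval big_cons -/(gval pi g w) mem_cat.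
case: ifP => _; last by rewrite add0r IH.
by rewrite addrC (map_f (fun v => v + t.1)) ?orbT.
Qed.

Lemma gval_grange g w : gval pi g w \in grange pi g.
Proof.
rewrite mem_sort mem_undup mem_filter gval_gcands andbT.
by apply/asboolP; exists w.
Qed.

Lemma grange_sorted g : sorted <%O (grange pi g).
Proof. by rewrite sort_lt_sorted undup_uniq. Qed.

End GambleValues.

Section Choquet.
Variables (R : realType) (W : Type).

Lemma esum_linear (J : finType) (x : J -> R) (nu : J -> set W -> R) X xs :
  esum (fun U => \sum_j x j * nu j U) X xs = \sum_j x j * esum (nu j) X xs.
Proof.
elim: xs => [|a [|c xs] IH]; try by rewrite /= big1 // => j _; rewrite mulr0.
rewrite /= -/(esum _ X (c :: xs)) IH mulr_sumr -big_split /=.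
by apply: eq_bigr => j _; rewrite mulrDr mulrCA.
Qed.

Lemma Echoquet_linear (J : finType) (x : J -> R) (nu : J -> set W -> R) X xs :
  \sum_j x j = 1 ->
  Echoquet (fun U => \sum_j x j * nu j U) X xs =
    \sum_j x j * Echoquet (nu j) X xs.
Proof.
case: xs => [_|a xs x_sum]; first by rewrite /= big1 // => j _; rewrite mulr0.
rewrite /Echoquet esum_linear -[a%:~R in LHS]mul1r -x_sum mulr_suml.
by rewrite -big_split /=; apply: eq_bigr => j _; rewrite mulrDr.
Qed.

Lemma esum_favors k (X : W -> int) V w a xs :
  is_extremum k X V w -> path <%O a xs -> (X w <= a) || (X w \in xs) ->
  esum (fun U => (favors k V U)%:R : R) X (a :: xs) = (Num.max a (X w) - a)%:~R.
Proof.
move=> ext; elim: xs a => [|c xs IH] a.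
  by rewrite in_nil orbF => _ /max_idPl ->; rewrite subrr.
rewrite /= -/(esum _ X (c :: xs)) (favors_gt _ ext) inE.
case/andP=> lt_ac c_path.
have [le_wa _|lt_aw] := leP (X w) a; last rewrite orFb => w_in.
  have le_wc : X w <= c by rewrite (le_trans le_wa) ?ltW.
  by rewrite IH ?le_wc // (max_idPl le_wc) !subrr mulr0 add0r.
have le_cw : c <= X w.
  have /orP [/eqP -> //|w_xs] := w_in.
  by rewrite ltW // (allP (order_path_min lt_trans c_path)).
rewrite IH //; last by have /orP [/eqP ->|->] := w_in; rewrite ?lexx ?orbT.
by rewrite (max_idPr le_cw) mulr1 -rmorphD /= addrC subrKA.
Qed.

Lemma expect_favors pi k g (V : set W) w : is_extremum k (gval pi g) V w ->
  expect pi (fun U => (favors k V U)%:R : R) g = (gval pi g w)%:~R.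
Proof.
move=> ext; have := gval_grange pi g w; have := grange_sorted pi g.
rewrite /expect /Echoquet; case: grange => [//|a xs] a_path.
rewrite inE => w_in; rewrite (esum_favors ext a_path).
  have le_aw : a <= gval pi g w.
    have /orP [/eqP -> //|w_xs] := w_in.
    by rewrite ltW // (allP (order_path_min lt_trans a_path)).
  by rewrite (max_idPr le_aw) -rmorphD /= subrKC.
by have /orP [/eqP ->|->] := w_in; rewrite ?lexx ?orbT.
Qed.

End Choquet.

Lemma expect_mixture (R : realType) (W J : finType) (pi : W -> nat -> bool) k
    (x : J -> R) (V : J -> {set W}) (w : J -> W) g :
  \sum_j x j = 1 ->
  (forall j, is_extremum k (gval pi g) [set` V j] (w j)) ->
  expect pi (mixture k x V) g = \sum_j x j * (gval pi g (w j))%:~R.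
Proof.
move=> x_sum ext; rewrite /expect /mixture Echoquet_linear //.
by apply: eq_bigr => j _; rewrite -(expect_favors R (ext j)).
Qed.

(** * Measures on finite sets as mixtures of focal sets *)

Lemma belief_incl_excl (R : realType) W (nu : set W -> R) (T : finType)
    (U : T -> set W) : is_belief nu ->
  \sum_(I : {set T} | (0 < #|I|)%N)
     (-1) ^+ #|I|.+1 * nu [set w | forall t, t \in I -> U t w]
  <= nu [set w | exists t, U t w].
Proof.
case=> _ _ _ /(_ _ (fun i : 'I_#|T| => U (enum_val i))); congr (_ <= nu _).
  pose ranks (I : {set T}) := [set enum_rank t | t in I]%SET.
  have ranks_bij : bijective ranks.
    exists (fun I : {set 'I_#|T|} => [set enum_val i | i in I]%SET) => I.
      rewrite /ranks -imset_comp -[RHS]imset_id.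
      by apply: eq_imset; apply: enum_rankK.
    rewrite /ranks -imset_comp -[RHS]imset_id.
    by apply: eq_imset; apply: enum_valK.
  rewrite (reindex ranks) /=; last exact: onW_bij.
  under eq_bigl do rewrite (card_imset _ enum_rank_inj).
  apply: eq_bigr => I _; rewrite (card_imset _ enum_rank_inj).
  congr (_ * nu _); apply/seteqP; split=> w /= wU t tI.
    by rewrite -(enum_rankK t); apply: wU; apply: imset_f.
  by case/imsetP: tI => u uI ->; rewrite enum_rankK; apply: wU.
apply/seteqP; split=> w /= [t Ut]; first by exists (enum_val t).
by exists (enum_rank t); rewrite enum_rankK.
Qed.

Section FiniteMeasures.
Variables (R : realType) (T : finType).

(* The union is [V] if [V] has at least two points, and empty otherwise. *)
Lemma belief_union_setD1_le (nu : set T -> R) (V : {set T}) : is_belief nu ->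
  nu [set w | exists t, (t \in V) && (w \in V :\ t)%SET] <= nu [set` V].
Proof.
case=> nu0 _ nu01 _.
have [[t [u [tV uV tu]]]|V_small] :=
  pselect (exists t u, [/\ t \in V, u \in V & t != u]).
  rewrite le_eqVlt; apply/orP; left; apply/eqP; congr nu.
  apply/seteqP; split=> w /= => [[s /andP [_]]|wV].
    by rewrite !inE => /andP [].
  have [->|wt] := eqVneq w t.
    by exists u; rewrite uV !inE tV tu.
  by exists t; rewrite tV !inE wV wt.
rewrite (_ : [set w | _] = classical_sets.set0).
  by rewrite nu0; have /andP [] := nu01 [set` V].
apply/seteqP; split=> w //= [t /andP [tV]]; rewrite !inE => /andP [wt wV].
by apply: V_small; exists t, w; rewrite tV wV eq_sym wt.
Qed.

(* Inclusion-exclusion for the family of the sets [V :\ t] with [t \in V]. *)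
Lemma belief_mobius_ge0 (nu : set T -> R) (V : {set T}) :
  is_belief nu -> 0 <= mobius (fun U : {set T} => nu [set` U]) V.
Proof.
move=> nu_bel; have [nu0 _ _ _] := nu_bel.
pose without t := [set w | (t \in V) && (w \in V :\ t)%SET].
have := le_trans (belief_incl_excl without nu_bel)
                 (belief_union_setD1_le V nu_bel).
rewrite -subr_ge0; congr (_ <= _).
rewrite mobius_complement [RHS](bigD1 set0) ?sub0set //=.
rewrite cards0 expr0 mul1r setD0; congr (_ + _).
rewrite -sumrN [LHS]big_mkcond [RHS]big_mkcond; apply: eq_bigr => I _.
rewrite card_gt0 [in RHS]andbC; case: (altP eqP) => //= I_neq0.
have [IV|/subsetPn [t tI tV]] := boolP (I \subset V); last first.
  rewrite (_ : [set w | _] = classical_sets.set0) ?nu0 ?mulr0 ?oppr0 //.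
  by apply/seteqP; split=> w //= /(_ t tI); rewrite /without /= (negPf tV).
rewrite exprS mulN1r mulNr opprK; congr (_ * nu _); apply/seteqP; split=> w /=.
  have /set0Pn [t tI] := I_neq0 => wI; have /andP [_] := wI t tI.
  rewrite !inE => /andP [_ ->]; rewrite andbT; apply/negP => /wI /andP [_].
  by rewrite !inE eqxx.
rewrite inE => /andP [wI wV] t tI; rewrite /without /= (subsetP IV) //=.
by rewrite !inE wV andbT; apply: contraNneq wI => ->.
Qed.

Lemma mobius_is_mass (nu : set T -> R) : nu classical_sets.set0 = 0 ->
  is_mass nu (mobius (fun U : {set T} => nu [set` U])).
Proof.
move=> nu0; split=> [|U]; last by rewrite mobiusK.
rewrite /mobius (big_pred1 set0) => [|B]; last by rewrite subset0.
by rewrite set_finset0 nu0 mulr0.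
Qed.

Lemma is_mass_mixture (nu : set T -> R) (m : {set T} -> R) :
  is_mass nu m -> nu = mixture Belief m id.
Proof.
case=> _ nuE; apply/funext => U; rewrite -[U]set_finsetK nuE big_mkcond.
apply: eq_bigr => V _.
by rewrite favors_belief; case: ifP; rewrite ?mulr1 ?mulr0.
Qed.

Lemma mixture_distribution k (m : {set T} -> R) :
  m set0 = 0 -> (forall V, 0 <= m V) ->
  is_measure k (mixture k m id) -> distribution m.
Proof.
move=> m0 m_ge0 mix_meas; split=> //.
transitivity (mixture k m id [set: T]); last by case: k mix_meas => -[].
apply: eq_bigr => V _; have [->|V_neq0] := eqVneq V set0.
  by rewrite m0 mul0r.
by rewrite favors_setT ?mulr1 //; apply: set_finset_nonempty.
Qed.

Lemma belief_mixture (nu : set T -> R) : is_belief nu ->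
  exists m : {set T} -> R,
    [/\ m set0 = 0, distribution m & nu = mixture Belief m id].
Proof.
move=> nu_bel; have [nu0 _ _ _] := nu_bel.
have m_mass := mobius_is_mass nu0; have nuE := is_mass_mixture m_mass.
have [m0 _] := m_mass; eexists; split; [exact: m0| |exact: nuE].
apply: (@mixture_distribution Belief) => // [V|]; last by rewrite /= -nuE.
exact: belief_mobius_ge0.
Qed.

Lemma possibility_mixture (nu : set T -> R) : is_possibility nu ->
  exists m : {set T} -> R,
    [/\ m set0 = 0, distribution m, {in [pred V | 0 < m V] &, nested id} &
        nu = mixture Possibility m id].
Proof.
move=> nu_poss; have [nu0 _ nuU] := nu_poss.
have [|m [m0 m_ge0 m_nested mE]] := @maxitive_mass R T (fun U => nu [set` U]).
  split=> [|A B]; first by rewrite set_finset0.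
  by rewrite -nuU; congr nu; apply/seteqP; split=> w /=; rewrite inE => /orP.
have nuE : nu = mixture Possibility m id.
  apply/funext => U; rewrite -[U]set_finsetK mE.
  by apply: eq_bigr => V _; rewrite favors_possibility.
exists m; split=> //; apply: (@mixture_distribution Possibility) => //.
by rewrite /= -nuE.
Qed.

Lemma measure_mixture k (nu : set T -> R) : is_measure k nu ->
  exists m : {set T} -> R,
    [/\ m set0 = 0, distribution m,
        k = Possibility -> {in [pred V | 0 < m V] &, nested id} &
        nu = mixture k m id].
Proof.
case: k => [/belief_mixture [m [m0 m_distr nuE]]|].
  by exists m.
by case/possibility_mixture => m [m0 m_distr m_nested nuE]; exists m.
Qed.

End FiniteMeasures.

Lemma mixture_enum_val (R : pzRingType) (W J : finType) k (x : J -> R)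
    (V : J -> {set W}) (A : {pred J}) :
  (forall j, j \notin A -> x j = 0) ->
  mixture k x V = mixture k (x \o @enum_val _ A) (V \o @enum_val _ A).
Proof.
move=> x_off_A; apply/funext => U.
rewrite /mixture (bigID (mem A)) /= [X in _ + X]big1 ?addr0.
  by rewrite big_enum_val.
by move=> j /x_off_A ->; rewrite mul0r.
Qed.

(** * Mixtures of focal sets as measures *)

Section MixtureMeasures.
Variables (R : realType) (W J : finType) (x : J -> R) (V : J -> {set W}).
Hypothesis x_distr : distribution x.
Hypothesis V_neq0 : forall j, V j != set0.

Lemma mixture_set0 k : mixture k x V classical_sets.set0 = 0.
Proof.
rewrite /mixture big1 // => j _.
by rewrite (favors_set0 _ (set_finset_nonempty (V_neq0 j))) mulr0.
Qed.

Lemma mixture_setT k : mixture k x V [set: W] = 1.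
Proof.
rewrite -(proj2 x_distr); apply: eq_bigr => j _.
by rewrite (favors_setT _ (set_finset_nonempty (V_neq0 j))) mulr1.
Qed.

Lemma mixture_belief : is_belief (mixture Belief x V).
Proof.
have [x_ge0 x_sum] := x_distr.
split; [exact: mixture_set0|exact: mixture_setT| |] => [U|n U].
  apply/andP; split; first by apply: sumr_ge0 => j _; rewrite mulr_ge0.
  rewrite -x_sum; apply: ler_sum => j _.
  by case: favors; rewrite ?mulr1 ?mulr0.
under eq_bigr do rewrite mulr_sumr.
rewrite exchange_big /=; apply: ler_sum => j _.
pose S := [set i | favors Belief [set` V j] (U i)]%SET.
have -> : \sum_(I : {set 'I_n} | (0 < #|I|)%N) (-1) ^+ #|I|.+1 *
    (x j * (favors Belief [set` V j] [set w | forall i, i \in I -> U i w])%:R)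
  = x j * (S != set0)%:R.
  rewrite -sum_sign_nonempty mulr_sumr; apply: eq_bigr => I _.
  rewrite mulrCA; congr (_ * (_ * _%:R)); congr nat_of_bool.
  apply/asboolP/subsetP => [VU i iI|IS w Vw i iI].
    by rewrite inE; apply/asboolP => w /VU; apply.
  by have := IS i iI; rewrite inE => /asboolP; apply.
apply: ler_wpM2l => //; rewrite ler_nat; case: (boolP (S == _)) => //=.
case/set0Pn => i; rewrite inE => /asboolP VU.
by rewrite lt0b; apply/asboolP => w /VU Uw; exists i.
Qed.

Lemma mixture_possibility :
  nested V -> is_possibility (mixture Possibility x V).
Proof.
move=> V_nested; have [x_ge0 _] := x_distr.
split; [exact: mixture_set0|exact: mixture_setT|] => A B.
pose hits j U := favors Possibility [set` V j] U.
have hits_sub i j U : V i \subset V j -> hits i U -> hits j U.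
  move=> /subsetP Vij /asboolP [w [/Vij Vw Uw]].
  by apply/asboolP; exists w.
have mixture_le C D : (forall j, hits j C ==> hits j D) ->
    mixture Possibility x V C <= mixture Possibility x V D.
  move=> CD; apply: ler_sum => j _; apply: ler_wpM2l => //; rewrite ler_nat.
  by have := CD j; rewrite /hits; do 2 case: favors.
have [/forallP AB|] := boolP [forall j, hits j A ==> hits j B].
  rewrite (max_idPr (mixture_le _ _ AB)); apply: eq_bigr => j _.
  by have := AB j; rewrite /hits favors_setU; do 2 case: favors.
rewrite negb_forall => /existsP [i]; rewrite negb_imply => /andP [iA iB].
have BA j : hits j B ==> hits j A.
  apply/implyP => jB; have /orP [/hits_sub|/hits_sub] := V_nested i j.
    exact.
  by move/(_ _ jB); rewrite (negPf iB).
rewrite (max_idPl (mixture_le _ _ BA)); apply: eq_bigr => j _.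
by have := BA j; rewrite /hits favors_setU; do 2 case: favors.
Qed.

Lemma mixture_is_measure k :
  (k = Possibility -> nested V) -> is_measure k (mixture k x V).
Proof.
case: k => [_|/(_ erefl)]; [exact: mixture_belief|exact: mixture_possibility].
Qed.

End MixtureMeasures.

Definition to_belief (R : realType) W (k : measure_kind) (nu : set W -> R) :
  set W -> R :=
  match k with Belief => nu | Possibility => poss_dual nu end.

Section MixtureMass.
Variables (R : realType) (W J : finType) (x : J -> R) (V : J -> {set W}).

Definition mixture_mass (U : {set W}) : R := \sum_(j | V j == U) x j.

Lemma mixture_is_mass : (forall j, V j != set0) ->
  is_mass (mixture Belief x V) mixture_mass.
Proof.
move=> V_neq0; split=> [|U].
  by rewrite /mixture_mass big_pred0 // => j; apply/negbTE.
rewrite /mixture_mass (exchange_big_dep predT) //=; apply: eq_bigr => j _.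
rewrite favors_belief; have [VU|VU] := boolP (V j \subset U).
  rewrite mulr1 (big_pred1 (V j)) // => B.
  by apply/andP/eqP => [[_ /eqP]|->].
by rewrite mulr0 big_pred0 // => B; apply: contraNF VU => /andP [BU /eqP ->].
Qed.

Lemma to_belief_mixture k : \sum_j x j = 1 ->
  to_belief k (mixture k x V) = mixture Belief x V.
Proof.
case: k => // x_sum; apply/funext => U; rewrite /= /poss_dual -x_sum -sumrB.
apply: eq_bigr => j _; rewrite favors_belief_setC.
by case: favors; rewrite /= ?mulr0 ?mulr1 ?subrr ?subr0.
Qed.

Lemma mixture_mass_gt0 U : injective V -> 0 < mixture_mass U ->
  exists2 j, V j = U & mixture_mass U = x j.
Proof.
move=> V_inj; have [/existsP [j /eqP jU] _|/existsPn not_focal] :=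
  boolP [exists j, V j == U].
  exists j => //; rewrite /mixture_mass (big_pred1 j) // => i.
  by rewrite -jU (inj_eq V_inj).
by rewrite /mixture_mass big_pred0 ?ltxx // => j; apply/negbTE.
Qed.

Lemma mixture_mass_card : injective V ->
  (#|[pred U | (0 < mixture_mass U)%R]| <= #|J|)%N.
Proof.
move=> V_inj; rewrite -cardsT -(card_imset _ V_inj); apply: subset_leq_card.
apply/subsetP => U; rewrite inE => /(mixture_mass_gt0 V_inj) [j <- _].
exact: imset_f.
Qed.

End MixtureMass.

(** * Inequalities and gambles of a formula *)

HB.instance Definition _ := gen_eqMixin pform.

Definition ineq : Type := (seq (int * gamble) * int)%type.

Fixpoint ineqs (f : fml) : seq ineq :=
  match f with
  | Ineq ts b => [:: (ts, b)]
  | FNot g => ineqs g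
  | FAnd g h => ineqs g ++ ineqs h
  end.

Definition gambles (f : fml) : seq gamble :=
  flatten [seq [seq t.2 | t <- q.1] | q <- ineqs f].

Definition slack (R : pzRingType) (q : ineq) (e : gamble -> R) : R :=
  \sum_(t <- q.1) t.1%:~R * e t.2 - q.2%:~R.

Lemma gambles_mem f q t : q \in ineqs f -> t \in q.1 -> t.2 \in gambles f.
Proof.
by move=> qf tq; apply/flattenP; exists [seq t.2 | t <- q.1]; apply: map_f.
Qed.

Lemma gambles_atoms f g : g \in gambles f -> {subset gatoms g <= fatoms f}.
Proof.
rewrite /gambles; elim: f => [ts b|f IH|f1 IH1 f2 IH2] //=.
  rewrite cats0 => /mapP [t tts ->] n nt; apply/flattenP.
  by exists (gatoms t.2) => //; apply: (map_f (fun t => gatoms t.2)).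
rewrite map_cat flatten_cat mem_cat => /orP [/IH1|/IH2] atoms n /atoms nf;
  by rewrite mem_cat nf ?orbT.
Qed.

Section Agreement.
Variables (W W' : Type) (pi : W -> nat -> bool) (pi' : W' -> nat -> bool).

Lemma peval_agree w w' p :
  {in patoms p, pi w =1 pi' w'} -> peval pi w p = peval pi' w' p.
Proof.
elim: p => [n|p IH|p IHp q IHq] /= agree; first by apply: agree; rewrite inE.
  by rewrite IH.
by rewrite IHp ?IHq // => n np; apply: agree; rewrite mem_cat np ?orbT.
Qed.

Lemma gval_agree w w' g :
  {in gatoms g, pi w =1 pi' w'} -> gval pi g w = gval pi' g w'.
Proof.
move=> agree; apply: eq_big_seq => t tg; rewrite (@peval_agree w w') //.
move=> n nt; apply: agree; apply/flattenP; exists (patoms t.2) => //.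
exact: (map_f (fun t => patoms t.2)).
Qed.

Variables (R : realType) (nu : set W -> R) (nu' : set W' -> R).

Lemma eq_sat_slack f :
  (forall q, q \in ineqs f ->
    (0 <= slack q (expect pi nu)) = (0 <= slack q (expect pi' nu'))) ->
  sat pi nu f <-> sat pi' nu' f.
Proof.
elim: f => [ts b|f IH|f IHf g IHg] /= same_sign.
- by have := same_sign (ts, b); rewrite /slack !subr_ge0 inE => ->.
- by rewrite IH.
- by rewrite IHf ?IHg // => q qf; apply: same_sign; rewrite mem_cat qf ?orbT.
Qed.

Lemma eq_sat_expect f : {in gambles f, expect pi nu =1 expect pi' nu'} ->
  sat pi nu f <-> sat pi' nu' f.
Proof.
move=> eq_expect; apply: eq_sat_slack => q qf; congr (0 <= _ - _).
by apply: eq_big_seq => t tq; rewrite eq_expect // (gambles_mem qf).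
Qed.

End Agreement.

Lemma slack_mixture (R : pzRingType) (J : finType) (x : J -> R)
    (v : J -> gamble -> int) q :
  \sum_j x j = 1 ->
  slack q (fun g => \sum_j x j * (v j g)%:~R) =
    \sum_j x j * (slack q (v j))%:~R.
Proof.
move=> x_sum; rewrite /slack.
have -> : q.2%:~R = \sum_j x j * q.2%:~R by rewrite -mulr_suml x_sum mul1r.
under eq_bigr do rewrite mulr_sumr.
rewrite exchange_big -sumrB; apply: eq_bigr => j _.
rewrite rmorphB /= intz mulrBr rmorph_sum mulr_sumr; congr (_ - _).
by apply: eq_bigr => t _; rewrite rmorphM /= intz !mulrA (commr_int (x j)).
Qed.

(** * Size bounds *)

Lemma ineqs_size f : (size (ineqs f) < fsize f)%N.
Proof. by elim: f => [ts b|f IH|f IHf g IHg] /=; rewrite ?size_cat; lia. Qed.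

Lemma gambles_size f : (size (gambles f) < fsize f)%N.
Proof.
rewrite /gambles; elim: f => [ts b|f IH|f IHf g IHg] /=; last 2 first.
- lia.
- by rewrite map_cat flatten_cat size_cat; lia.
rewrite cats0 size_map.
suff : (size ts <= \sum_(t <- ts) (2 + gsize t.2))%N by lia.
by rewrite -sum1_size; apply: leq_sum => t _; lia.
Qed.

Lemma ineqs_fsize f q : q \in ineqs f -> (fsize (Ineq q.1 q.2) <= fsize f)%N.
Proof.
elim: f => [ts b|f IH|f IHf g IHg] /=; first by rewrite inE => /eqP ->.
  by move=> /IH /=; lia.
by rewrite mem_cat => /orP [/IHf|/IHg] /=; lia.
Qed.

Lemma ineqs_fmaxlen f q : q \in ineqs f ->
  (fmaxlen (Ineq q.1 q.2) <= fmaxlen f)%N.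
Proof.
elim: f => [ts b|f IH|f IHf g IHg] /=; first by rewrite inE => /eqP ->.
  exact: IH.
by rewrite mem_cat => /orP [/IHf|/IHg] /=; lia.
Qed.

Lemma fsize_gt1 f : (1 < fsize f)%N.
Proof. by elim: f => [ts b|f IH|f IHf g IHg] /=; lia. Qed.

Lemma fmaxlen_gt0 f : (0 < fmaxlen f)%N.
Proof. by elim: f => [ts b|f IH|f IHf g IHg] /=; rewrite ?leq_max ?IHf. Qed.

Lemma size_le_gsize g : (size g <= gsize g)%N.
Proof.
rewrite /gsize -sum1_size; apply: leq_trans (leq_addr _ _).
exact: leq_sum.
Qed.

Lemma gval_norm_le W (pi : W -> nat -> bool) g w l : (gmaxlen g <= l)%N ->
  `|gval pi g w| <= (size g)%:R * 2 ^+ l.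
Proof.
move=> /bigmax_leqP_seq coef_le; apply: le_trans (ler_norm_sum _ _ _) _.
apply: (@le_trans _ _ (\sum_(t <- g) 2 ^+ l)).
  rewrite big_seq [leRHS]big_seq; apply: ler_sum => t tg.
  by case: ifP => _; rewrite ?normr0 ?exprn_ge0 // normz_le_bitlen // coef_le.
by rewrite big_const_seq count_predT iter_addr_0 -[leLHS]mulr_natl.
Qed.

Definition coef_bound (f : fml) : int := (fsize f)%:R * 2 ^+ (fmaxlen f).*2.

Lemma coef_bound_ge1 f : 1 <= coef_bound f.
Proof. by rewrite mulr_ege1 ?exprn_ege1 // ler1n ltnW ?fsize_gt1. Qed.

Lemma slack_norm_le f q (v : gamble -> int) : q \in ineqs f ->
  (forall g, (gmaxlen g <= fmaxlen f)%N ->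
     `|v g| <= (size g)%:R * 2 ^+ fmaxlen f) ->
  `|slack q v| <= coef_bound f.
Proof.
move=> qf v_le; have := ineqs_fmaxlen qf; have := ineqs_fsize qf.
rewrite /coef_bound /= geq_max.
set l := fmaxlen f in v_le * => q_size /andP [/normz_le_bitlen rhs_le].
move=> /bigmax_leqP_seq terms_le.
have pow_double : 2 ^+ l.*2 = 2 ^+ l * 2 ^+ l :> int by rewrite -addnn exprD.
have term_le t : t \in q.1 ->
    `|t.1%:~R * v t.2| <= (2 + gsize t.2)%:R * 2 ^+ l.*2.
  move=> tq; have := terms_le t tq isT.
  rewrite geq_max => /andP [/normz_le_bitlen coef_le /v_le val_le].
  rewrite intz normrM pow_double mulrCA.
  apply: ler_pM => //; apply: le_trans val_le _.
  by rewrite ler_wpM2r ?exprn_ge0 // ler_nat ltnW // ltnS leqW ?size_le_gsize.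
have sum_le : `|\sum_(t <- q.1) t.1%:~R * v t.2| <=
    \sum_(t <- q.1) (2 + gsize t.2)%:R * 2 ^+ l.*2.
  apply: le_trans (ler_norm_sum _ _ _) _.
  by rewrite big_seq [leRHS]big_seq; apply: ler_sum.
have {}rhs_le : `|q.2%:~R : int| <= 2 ^+ l.*2.
  by rewrite intz (le_trans rhs_le) // ler_weXn2l // -addnn leq_addr.
apply: le_trans (ler_normB _ _) (le_trans (lerD sum_le rhs_le) _).
rewrite -mulr_suml -natr_sum -[X in _ + X]mul1r -mulrDl ler_wpM2r ?exprn_ge0 //.
by rewrite natr1 ler_nat (leq_trans _ q_size) // -addnA -addn1 leq_add2l addn2.
Qed.

Definition size_bound (f : fml) : nat :=
  fsize f * fmaxlen f + fsize f * Nat.log2 (fsize f).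

Lemma size_bound_gt0 f : (0 < size_bound f)%N.
Proof. by rewrite addn_gt0 muln_gt0 fmaxlen_gt0 andbT ltnW ?fsize_gt1. Qed.

Lemma fact_le_expn n m : (n <= m)%N -> (n`! <= m ^ n)%N.
Proof.
elim: n => // n IH lt_nm; rewrite factS expnS leq_mul // IH //; exact: ltnW.
Qed.

Lemma fsize_le_exp_log2 f : (fsize f <= 2 ^ (Nat.log2 (fsize f)).*2)%N.
Proof.
have log_gt0 : (0 < Nat.log2 (fsize f))%N.
  by rewrite log2_trunc_log trunc_log_gt0 fsize_gt1.
apply: leq_trans (ltnW (trunc_log_ltn (fsize f) (isT : 1 < 2)%N)) _.
by rewrite -log2_trunc_log leq_exp2l //; lia.
Qed.

Lemma cramer_bound_le_exp f N : (N <= fsize f)%N ->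
  N%:R * cramer_bound N (coef_bound f) <= 2 ^+ (6 * size_bound f).
Proof.
rewrite /cramer_bound /coef_bound -!natrX -natrM -natrX -!natrM ler_nat.
have F_le := fsize_le_exp_log2 f; have F_gt1 := fsize_gt1 f.
set F := fsize f in F_le F_gt1 *; set L := (Nat.log2 F).*2 in F_le.
set l := fmaxlen f => le_NF.
have leq_pow a b : (0 < a)%N -> (a <= b)%N -> (a ^ N <= b ^ F)%N.
  move=> a_gt0 le_ab; apply: (@leq_trans (a ^ F)); first by rewrite leq_pexp2l.
  by rewrite leq_exp2r // ltnW.
apply: (@leq_trans (2 ^ L * ((2 ^ L) ^ F * (2 ^ L * 2 ^ l.*2) ^ F))).
  rewrite !leq_mul ?leq_pow ?leq_mul // ?(leq_trans le_NF) //.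
    by rewrite (leq_trans (fact_le_expn le_NF)) // leq_pow // ltnW.
  by rewrite muln_gt0 expn_gt0 (ltnW F_gt1).
by rewrite -!expnD -!expnM -!expnD leq_exp2l // /size_bound -/F -/l /L; nia.
Qed.

(** * Reduction to finitely many worlds *)

Section Preimage.
Variables (R : realType) (W T : Type) (h : W -> T) (nu : set W -> R).

Lemma is_measure_preimage k :
  is_measure k nu -> is_measure k (fun U => nu (h @^-1` U)).
Proof.
case: k => [[nu0 nuT nu01 nu_incl]|[nu0 nuT nuU]].
  by split=> // n U; apply: nu_incl.
by split=> // U V; apply: nuU.
Qed.

Lemma esum_preimage (X : T -> int) xs :
  esum (fun U => nu (h @^-1` U)) X xs = esum nu (X \o h) xs.
Proof. by elim: xs => // a [|c xs] //= ->. Qed.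

Lemma expect_preimage (pi : W -> nat -> bool) (pi' : T -> nat -> bool) g :
  (forall t, exists w, h w = t) ->
  (forall w, {in gatoms g, pi' (h w) =1 pi w}) ->
  expect pi' (fun U => nu (h @^-1` U)) g = expect pi nu g.
Proof.
move=> h_surj agree.
have gvalE : gval pi' g \o h = gval pi g.
  by apply/funext => w; apply: gval_agree.
rewrite /expect; have -> : grange pi' g = grange pi g.
  congr (sort _ (undup _)); apply: eq_filter => v; apply: asbool_equiv_eq.
  split=> [[t <-]|[w <-]]; last by exists (h w); rewrite -gvalE.
  by have [w <-] := h_surj t; exists w; rewrite -gvalE.
by case: grange => // a xs; rewrite /Echoquet esum_preimage gvalE.
Qed.

End Preimage.

(* The new worlds are the tuples of truth values of the atoms of [f] that are
   realized in [W]. *)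
Lemma finite_quotient (R : realType) k f W (nu : set W -> R)
    (pi : W -> nat -> bool) :
  is_measure k nu -> sat pi nu f ->
  exists (T : finType) (nu' : set T -> R) (pi' : T -> nat -> bool),
    [/\ is_measure k nu', sat pi' nu' f &
        forall t p, p \notin fatoms f -> pi' t p = false].
Proof.
move=> nu_meas nu_sat; pose s := fatoms f.
pose truth w := map_tuple (pi w) (in_tuple s).
pose realized := [pred a | `[< exists w, truth w = a >]].
have truth_realized w : realized (truth w) by apply/asboolP; exists w.
pose h w : {a | realized a} := exist _ (truth w) (truth_realized w).
pose pi' (t : {a | realized a}) p := nth false (val t) (index p s).
exists {a | realized a}, (fun U => nu (h @^-1` U)), pi'; split.
- exact: is_measure_preimage.
- apply: (proj2 (eq_sat_expect _) nu_sat) => g gf; apply: expect_preimage.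
    move=> [a a_realized]; have /asboolP [w wa] := a_realized.
    by exists w; apply: val_inj.
  move=> w p /(gambles_atoms gf) ps.
  by rewrite /pi' /= (nth_map 0%N) ?index_mem // nth_index.
- move=> a p ps; rewrite /pi' /= nth_default // size_tuple.
  by rewrite leqNgt index_mem.
Qed.

(** * Small models *)

Definition small_mass (R : realType) (W : finType) (nu : set W -> R)
    (N b : nat) : Prop :=
  exists m : {set W} -> R,
    [/\ is_mass nu m, (#|[pred V : {set W} | (0 < m V)%R]| <= N)%N &
        forall V, 0 < m V ->
          exists q : rat, m V = ratr q /\ (ratsize q <= b)%N].

Definition small_model (R : realType) (k : measure_kind) (f : fml) (W : finType)
    (nu : set W -> R) (pi : W -> nat -> bool) : Prop :=
  [/\ (0 < #|W|)%N, is_measure k nu, sat pi nu f, (#|W| <= fsize f ^ 2)%N &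
      small_mass (to_belief k nu) (fsize f) (14 * size_bound f) /\
      forall w p, p \notin fatoms f -> pi w p = false].

Lemma mixture_small_mass (R : realType) (W J : finType) k (y : J -> rat)
    (V : J -> {set W}) N b :
  distribution y -> (forall j, V j != set0) -> injective V ->
  (#|J| <= N)%N -> (forall j, (ratsize (y j) <= b)%N) ->
  small_mass (to_belief k (mixture k (fun j => ratr (y j) : R) V)) N b.
Proof.
move=> /(distribution_ratr R) [_ y_sum] V_neq0 V_inj card_J y_size.
exists (mixture_mass (fun j => ratr (y j)) V); split.
- by rewrite to_belief_mixture //; apply: mixture_is_mass.
- exact: leq_trans (mixture_mass_card _ V_inj) card_J.
- by move=> U /(mixture_mass_gt0 V_inj) [j _ ->]; exists (y j).
Qed.

Lemma sparse_mixture (R : realType) k f (T : finType) (pi : T -> nat -> bool) n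
    (x : 'I_n -> R) (V : 'I_n -> {set T}) :
  distribution x -> (forall j, V j != set0) -> sat pi (mixture k x V) f ->
  exists y : 'I_n -> rat,
    [/\ distribution y, sat pi (mixture k (fun j => ratr (y j) : R) V) f,
        (#|[pred j | y j != 0%R]| <= fsize f)%N &
        forall j, (ratsize (y j) <= 14 * size_bound f)%N].
Proof.
move=> x_distr V_neq0 x_sat.
have [w w_ext] := gval_extremum_choice k pi V_neq0.
pose q := tnth (in_tuple (ineqs f)).
pose A := \matrix_(i, j) slack (q i) (fun g => gval pi g (w j g)).
have slackE (z : 'I_n -> R) i : distribution z ->
    slack (q i) (expect pi (mixture k z V)) = \sum_j z j * (A i j)%:~R.
  move=> [_ z_sum]; under [RHS]eq_bigr do rewrite mxE.
  rewrite -slack_mixture //; congr slack; apply/funext => g.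
  exact: expect_mixture.
have A_le : entries_le (coef_bound f) A.
  move=> i j; rewrite mxE; apply: slack_norm_le; first exact: mem_tnth.
  by move=> g; apply: gval_norm_le.
have [y [y_distr y_sign y_card y_size]] := small_distribution
  (coef_bound_ge1 f) A_le x_distr (cramer_bound_le_exp (ineqs_size f)).
exists y; split=> // [||j].
- apply: (proj1 (eq_sat_slack _) x_sat) => q0.
  rewrite -[ineqs f]/(val (in_tuple (ineqs f))) => /tnthP [i ->].
  rewrite -/(q i).
  by rewrite !slackE ?y_sign //; apply: distribution_ratr.
- exact: leq_trans y_card (ineqs_size f).
- (* [2 (6 b + 1) <= 14 b] for [b >= 1] *)
  by apply: leq_trans (y_size j) _; have := size_bound_gt0 f; lia.
Qed.

Section Downsets.
Variables (I J T : finType) (V : J -> {set T}).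

(* A world [(i, c)] stands for the [c]-th witness chosen in [V i]; [downset j]
   gathers the witnesses that are bound to lie in [V j]. *)
Definition downset (j : J) : {set J * I} := [set w | V w.1 \subset V j]%SET.

Lemma mem_downset j c : (j, c) \in downset j.
Proof. by rewrite inE. Qed.

Lemma downset_neq0 (c : I) j : downset j != set0.
Proof. by apply/set0Pn; exists (j, c); apply: mem_downset. Qed.

Lemma downset_inj (c : I) : injective V -> injective downset.
Proof.
move=> V_inj i j ij; apply: V_inj; apply/eqP; rewrite eqEsubset.
have := mem_downset i c; rewrite {1}ij inE => -> /=.
by have := mem_downset j c; rewrite -{1}ij inE.
Qed.

Lemma nested_downset : nested V -> nested downset.
Proof.
have sub i j : V i \subset V j -> downset i \subset downset j.
  move=> ij; apply/subsetP => w; rewrite !inE => wi.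
  exact: subset_trans ij.
move=> V_nested i j.
by have /orP [/sub ->|/sub ->] := V_nested i j; rewrite ?orbT.
Qed.

End Downsets.

Lemma witness_model (R : realType) k f (T J : finType) (pi : T -> nat -> bool)
    (x : J -> R) (V : J -> {set T}) :
  distribution x -> (forall j, V j != set0) -> sat pi (mixture k x V) f ->
  exists wit : J * 'I_(size (gambles f)).+1 -> T,
    sat (pi \o wit) (mixture k x (downset _ V)) f.
Proof.
move=> [_ x_sum] V_neq0 x_sat.
have [w w_ext] := gval_extremum_choice k pi V_neq0.
pose wit (p : J * 'I_(size (gambles f)).+1) :=
  w p.1 (nth [::] (gambles f) p.2).
exists wit; apply: (proj1 (eq_sat_expect _) x_sat) => g gf.
have g_index : (index g (gambles f) < (size (gambles f)).+1)%N.
  by rewrite ltnS index_size.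
have gvalE p : gval (pi \o wit) g p = gval pi g (wit p) by apply: gval_agree.
rewrite (expect_mixture x_sum (fun j => w_ext j g)).
rewrite (@expect_mixture _ _ _ _ _ _ _ (fun j => (j, Ordinal g_index))) //.
  by apply: eq_bigr => j _; rewrite gvalE /wit /= nth_index.
move=> j; split=> [|p]; rewrite /= inE //= !gvalE /wit /= nth_index //.
move=> /subsetP Vp.
have [Vw _] := w_ext p.1 (nth [::] (gambles f) p.2).
by have [_] := w_ext j g; apply; apply: Vp.
Qed.

Lemma small_model_of_mixture (R : realType) k f (T : finType)
    (pi : T -> nat -> bool) n (x : 'I_n -> R) (V : 'I_n -> {set T}) :
  (forall t p, p \notin fatoms f -> pi t p = false) ->
  distribution x -> (forall j, V j != set0) -> injective V ->
  (k = Possibility -> nested V) -> sat pi (mixture k x V) f ->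
  exists (W : finType) (nu : set W -> R) (pi' : W -> nat -> bool),
    small_model k f nu pi'.
Proof.
move=> pi_off_f x_distr V_neq0 V_inj V_nested x_sat.
have [y [y_distr y_sat y_card y_size]] := sparse_mixture x_distr V_neq0 x_sat.
pose A := [pred j | y j != 0].
have y_off_A j : j \notin A -> y j = 0 by rewrite negbK => /eqP.
pose z := y \o @enum_val _ A; pose U := V \o @enum_val _ A.
have z_distr : distribution z by apply: distribution_enum_val.
have zR_distr := distribution_ratr R z_distr.
have U_inj : injective U by move=> i j /V_inj /enum_val_inj.
have U_sat : sat pi (mixture k (fun i => ratr (z i) : R) U) f.
  move: y_sat; rewrite (@mixture_enum_val _ _ _ _ _ _ A) // => j /y_off_A ->.
  by rewrite rmorph0.
have [wit wit_sat] := witness_model zR_distr (fun i => V_neq0 _) U_sat.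
exists ('I_#|A| * 'I_(size (gambles f)).+1)%type.
exists (mixture k (fun i => ratr (z i)) (downset _ U)), (pi \o wit); split.
- rewrite card_prod !card_ord muln_gt0.
  by have := distribution_card_gt0 z_distr; rewrite card_ord => ->.
- apply: mixture_is_measure => // [i|/V_nested V_nest].
    exact: downset_neq0 ord0 i.
  by apply: nested_downset => i j; apply: V_nest.
- exact: wit_sat.
- by rewrite card_prod !card_ord expnS expn1 leq_mul // gambles_size.
- split=> [|w p]; last exact: pi_off_f.
  apply: mixture_small_mass => // [i|||i].
  + exact: downset_neq0 ord0 i.
  + exact: downset_inj ord0 U_inj.
  + by rewrite card_ord.
  + exact: y_size.
Qed.

Theorem small_model_exists (R : realType) k f :
  (exists (W : Type) (nu : set W -> R) (pi : W -> nat -> bool),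
     is_measure k nu /\ sat pi nu f) ->
  exists (W : finType) (nu : set W -> R) (pi : W -> nat -> bool),
    small_model k f nu pi.
Proof.
case=> W [nu [pi [nu_meas nu_sat]]].
have [T [nu' [pi' [nu'_meas nu'_sat pi'_off_f]]]] :=
  finite_quotient nu_meas nu_sat.
have [m [m0 m_distr m_nested nu'E]] := measure_mixture nu'_meas.
pose A := [pred V : {set T} | 0 < m V].
have m_off_A V : V \notin A -> m V = 0.
  rewrite inE -leNgt => m_le0; apply/eqP.
  by rewrite eq_le m_le0 (proj1 m_distr).
apply: (small_model_of_mixture pi'_off_f (distribution_enum_val m_off_A m_distr)
         (V := @enum_val _ A)).
- move=> j; have : 0 < m (enum_val j) := enum_valP j.
  by apply: contraTneq => ->; rewrite m0 ltxx.
- exact: enum_val_inj.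
- by move=> /m_nested A_nested i j; apply: A_nested; apply: enum_valP.
- by rewrite -(mixture_enum_val k id m_off_A) -nu'E.
Qed.

Theorem theorem6p2 :
  exists C : nat, forall (R : realType) (f : fml),
  (* belief structures *)
  ((exists (W : Type) (nu : set W -> R) (pi : W -> nat -> bool),
      inhabited W /\ is_belief nu /\ sat pi nu f) ->
   exists (W : finType) (nu : set W -> R) (pi : W -> nat -> bool),
     [/\ (0 < #|W|)%N, is_belief nu, sat pi nu f,
         (#|W| <= fsize f ^ 2)%N &
         ((exists m : {set W} -> R,
            [/\ is_mass nu m,
                (#|[pred V : {set W} | (0 < m V)%R]| <= fsize f)%N &
                forall V, 0 < m V -> exists q : rat,
                  m V = ratr q /\
                  (ratsize q <= C * (fsize f * fmaxlen f
                                     + fsize f * Nat.log2 (fsize f)))%N]) /\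
         forall w p, p \notin fatoms f -> pi w p = false)])
  /\
  (* possibility structures *)
  ((exists (W : Type) (nu : set W -> R) (pi : W -> nat -> bool),
      inhabited W /\ is_possibility nu /\ sat pi nu f) ->
   exists (W : finType) (nu : set W -> R) (pi : W -> nat -> bool),
     [/\ (0 < #|W|)%N, is_possibility nu, sat pi nu f,
         (#|W| <= fsize f ^ 2)%N &
         ((exists m : {set W} -> R,
            [/\ is_mass (poss_dual nu) m,
                (#|[pred V : {set W} | (0 < m V)%R]| <= fsize f)%N &
                forall V, 0 < m V -> exists q : rat,
                  m V = ratr q /\
                  (ratsize q <= C * (fsize f * fmaxlen f
                                     + fsize f * Nat.log2 (fsize f)))%N]) /\
         forall w p, p \notin fatoms f -> pi w p = false)]).
Proof.
exists 14%N => R f; split=> -[W [nu [pi [_ [nu_meas nu_sat]]]]].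
- by apply: (@small_model_exists R Belief f); exists W, nu, pi.
- by apply: (@small_model_exists R Possibility f); exists W, nu, pi.
Qed.
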